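(* Let $n\in\mathbb{N}=\{1,2,\dots\}$, $0\le i\le n-1$ and $\alpha,\beta>-1$. Let $t_1<\dots<t_n$ be the zeros of $P_n^{(\alpha,\beta)}$, and let $n_0\in\{0,1,\dots,n\}$ be such that $0\in[t_{n_0},t_{n_0+1})$, with the conventions $t_0=-1$, $t_{n+1}=1$. Write $$A_m:=\sum_{k=0}^i\frac{2^{k+2}\Gamma(n+\alpha+\beta+1)}{\Gamma(n+k+\alpha+\beta+2)}\frac{t_m^{i-k}}{(i-k)!}p_{n-1-k}^{(\alpha+1+k,\beta+1+k)}(t_m).$$ (i) If $i$ is even, then $$\int_{-1}^1\frac{|t|^i}{i!}|p_n^{(\alpha,\beta)}(t)|\,dt=\sum_{m=1}^n(-1)^{m+n}A_m.$$ (ii) If $i$ is odd, then $$\int_{-1}^1\frac{|t|^i}{i!}|p_n^{(\alpha,\beta)}(t)|\,dt=\sum_{m=1}^{n_0}(-1)^{m+n+1}A_m+(-1)^{n_0+n}\frac{2^{i+2}\Gamma(n+\alpha+\beta+1)}{\Gamma(n+i+\alpha+\beta+2)}p_{n-1-i}^{(\alpha+1+i,\beta+1+i)}(0)+\sum_{m=n_0+1}^n(-1)^{m+n}A_m.$$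
   Context: The Jacobi polynomials are $P_n^{(\alpha,\beta)}(t)=\sum_{j=0}^n\frac{1}{2^n}\binom{n+\alpha}{n-j}\binom{n+\beta}{j}(t-1)^j(t+1)^{n-j}$; for $\alpha,\beta>-1$ their zeros are real, simple and lie in $(-1,1)$. The Jacobi functions on $(-1,1)$ are $p_n^{(\alpha,\beta)}(t)=\frac{(2n+\alpha+\beta+1)\Gamma(n+\alpha+\beta+1)\,n!}{2^{\alpha+\beta+1}\Gamma(n+\alpha+1)\Gamma(n+\beta+1)}(1-t)^{\alpha}(1+t)^{\beta}P_n^{(\alpha,\beta)}(t)$. *)

(* Defs.v *)
From HB Require Import structures.
From mathcomp Require Import all_boot all_order all_algebra.
From mathcomp Require Import all_classical all_reals all_analysis.
Set Implicit Arguments. Unset Strict Implicit. Unset Printing Implicit Defensive.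
Import Order.TTheory GRing.Theory Num.Theory.
Local Open Scope classical_set_scope.
Local Open Scope ring_scope.

Section Defs.
Variable R : realType.

(* Euler Gamma function, Gamma x = int_0^oo s^(x-1) e^(-s) ds (used for x > 0). *)
Definition Gamma (x : R) : R :=
  fine (\int[@lebesgue_measure R]_(s in `]0%R, +oo[)
          ((s `^ (x - 1)) * expR (- s))%:E).

Definition gbinom (x : R) (k : nat) : R :=
  (\prod_(l < k) (x - l%:R)) / (k`!)%:R.

Definition jacobiP (n : nat) (a b t : R) : R :=
  \sum_(j < n.+1) (2 ^+ n)^-1 * gbinom (n%:R + a) (n - j) * gbinom (n%:R + b) j
                   * (t - 1) ^+ j * (t + 1) ^+ (n - j).

Definition jacobip (n : nat) (a b t : R) : R :=
  (2 * n%:R + a + b + 1) * Gamma (n%:R + a + b + 1) * (n`!)%:R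
  / (2 `^ (a + b + 1) * Gamma (n%:R + a + 1) * Gamma (n%:R + b + 1))
  * (1 - t) `^ a * (1 + t) `^ b * jacobiP n a b t.

End Defs.

(* Main.v *)
Require Import Defs.
From HB Require Import structures.
From mathcomp Require Import all_boot all_order all_algebra.
From mathcomp Require Import all_classical all_reals all_analysis.
From mathcomp Require Import measurable_realfun ring lra.
Import Order.TTheory GRing.Theory Num.Theory.
Import numFieldNormedType.Exports.
Local Open Scope classical_set_scope.
Local Open Scope ring_scope.

(** The weighted polynomial [(1 - x)^(a+1) (1 + x)^(b+1) P_n^(a+1,b+1)] has
    derivative [- 2 (n + 1) (1 - x)^a (1 + x)^b P_(n+1)^(a,b)] and vanishes at
    both endpoints. By Rolle's theorem and induction, [P_n^(a,b)] has [n] zeros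
    in (-1, 1), hence no others, and it changes sign exactly at them. Repeated
    integration by parts gives [A] as [- 2] times a primitive of
    [x^i / i! * p_n^(a,b)], vanishing at both endpoints. Integrating the absolute
    value between consecutive sign changes (the zeros, and also 0 when [i] is
    odd) and summing by parts gives both formulas. *)

(** * Fundamental theorem of calculus on an open interval *)

Section FTC.
Context {R : realType}.
Notation mu := (@lebesgue_measure R).
Implicit Types (f F : R -> R) (a b : R).

(** The integrand may blow up at the endpoints, as the Jacobi weights do for negative parameters.
    Compact intervals [D k] exhaust []a, b[]; the integrals over them converge by monotone
    convergence, and the increments of [F] by its one-sided continuity at [a] and [b]. *)
Lemma ge0_derivable_oo_FTC2 f F a b : a < b ->
  {in `]a, b[, forall x, 0 <= f x} -> {in `]a, b[, continuous f} ->
  {within `[a, b], continuous F} ->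
  {in `]a, b[, forall x : R, is_derive x 1 F (f x)} ->
  (\int[mu]_(x in `[a, b]) (f x)%:E = (F b - F a)%:E)%E.
Proof.
move=> ab f0 cf cF dF.
have mf : measurable_fun `]a, b[ f.
  by apply: open_continuous_measurable_fun => //; exact/in_continuous_mksetP.
have F'f : {in `]a, b[, F^`()%classic =1 f}.
  by move=> x xab; have := dF x xab => ?; rewrite derive1E derive_val.
have {}dF : derivable_oo_LRcontinuous F a b.
  have [_ Fa Fb] := (continuous_within_itvP F ab).1 cF.
  by split=> // x /dF[].
(* A third of the length keeps [a + e k] below [b - e k] already at [k = 0]. *)
pose e (k : nat) := (b - a) / 3 * k.+1%:R^-1.
have e0 k : 0 < e k by rewrite /e mulr_gt0 ?divr_gt0 ?invr_gt0 ?subr_gt0.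
have e3 k : e k <= (b - a) / 3.
  by rewrite /e ler_piMr ?invf_le1 ?ler1n// divr_ge0 ?subr_ge0 ?ltW.
have eb k : a + e k < b - e k by have := e3 k; lra.
have ecvg : e @ \oo --> (0 : R).
  by rewrite -[X in _ --> X](mulr0 ((b - a) / 3)); apply: cvgMr => //; exact: cvg_harmonic.
pose D k := `[a + e k, b - e k]%classic.
have DU : \bigcup_k D k = `]a, b[%classic.
  apply/seteqP; split => [x [k _]|x]; rewrite /D /= !in_itv/=.
    by move=> /andP[x1 x2]; have := e0 k; lra.
  move=> /andP[ax xb].
  have : \forall k \near \oo, e k < Num.min (x - a) (b - x).
    have m0 : 0 < Num.min (x - a) (b - x) by rewrite lt_min !subr_gt0 ax xb.
    have := ecvg => /cvgrPdist_lt /(_ _ m0); apply: filterS => k.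
    by rewrite sub0r normrN gtr0_norm.
  case=> k _ /(_ k (leqnn k)); rewrite lt_min => /andP[k1 k2].
  by exists k => //=; rewrite in_itv/=; lra.
have Dab k : D k `<=` `]a, b[%classic by rewrite -DU; exact: bigcup_sup.
rewrite (@integral_itv_bndoo _ _ _ (fun x => (f x)%:E)); last exact/measurable_EFinP.
have := @ge0_nondecreasing_set_cvg_integral _ (measurableTypeR R) R D (EFin \o f) mu.
rewrite DU => /(_ _ _ _ _)/cvg_lim <- //; last 4 first.
- apply/nondecreasing_seqP => k; rewrite subsetEset => x; rewrite /D/= !in_itv/=.
  have : e k.+1 <= e k.
    by rewrite /e ler_pM2l ?divr_gt0 ?subr_gt0// lef_pV2 ?posrE// ler_nat.
  by lra.
- by move=> k; exact: measurable_itv.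
- by move=> k; apply/measurable_EFinP; apply: measurable_funS mf => //; exact: Dab.
- by move=> k x /Dab; rewrite /= lee_fin => /f0.
apply/cvg_lim => //.
have -> : (fun k => \int[mu]_(x in D k) (EFin \o f) x)%E
        = (fun k => (F (b - e k) - F (a + e k))%:E).
  apply/funext => k; rewrite (@continuous_FTC2 _ f F) //.
  - apply: continuous_in_subspaceT => x /set_mem/Dab xab; exact: cf.
  - have := Dab k; rewrite /D.
    move=> sub; apply: derivable_oo_continuousW dF => //.
    by apply: subset_trans sub _; exact: subset_itv_oo_cc.
  - move=> x xk; apply: F'f; apply: Dab; rewrite /D.
    exact: subset_itv_oo_cc xk.
case: dF => _ Fa Fb.
apply: cvg_EFin; first exact: nearW.
apply: cvgB.
- apply: (cvg_at_leftP F b (F b)).1 => //; split=> [k|].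
    by rewrite ltrBlDr ltrDl.
  by rewrite -[X in _ --> X]subr0; apply: cvgB => //; exact: cvg_cst.
- apply: (cvg_at_rightP F a (F a)).1 => //; split=> [k|].
    by rewrite ltrDl.
  by rewrite -[X in _ --> X]addr0; apply: cvgD => //; exact: cvg_cst.
Qed.

End FTC.

(** * Integral of an absolute value over pieces of alternating sign *)

Lemma ler_nodes (R : realType) (n : nat) (u : nat -> R) :
  (forall m, (m <= n)%N -> u m <= u m.+1) ->
  forall j k, (j <= k <= n.+1)%N -> u j <= u k.
Proof.
move=> u_le j; elim=> [|k IH] /andP[]; first by rewrite leqn0 => /eqP->.
rewrite leq_eqVlt => /predU1P[->//|jk] kn.
by apply: le_trans (u_le k kn); apply: IH; rewrite -ltnS jk ltnW.
Qed.

Section alternating.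
Context {R : realType}.
Notation mu := (@lebesgue_measure R).
Implicit Types (f F : R -> R) (a b : R).

Lemma ge0_integral_itv_cat f a b c : a <= b -> b <= c ->
  measurable_fun `[a, c] f -> {in `[a, c], forall x, 0 <= f x} ->
  (\int[mu]_(x in `[a, c]) (f x)%:E =
   \int[mu]_(x in `[a, b]) (f x)%:E + \int[mu]_(x in `[b, c]) (f x)%:E)%E.
Proof.
move=> ab bc mf f0.
have acE : `[a, c]%classic = `[a, b]%classic `|` `]b, c]%classic.
  by rewrite -itv_bndbnd_setU.
have {}f0 x : `[a, c]%classic x -> 0 <= f x by move=> /f0.
move: mf f0; rewrite acE => mf f0.
rewrite ge0_integral_setU//=; last 2 first.
- exact/measurable_EFinP.
- apply/disj_setPS => x /=; rewrite !in_itv/= => -[/andP[_ xb] /andP[bx _]].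
  by move: (lt_le_trans bx xb); rewrite ltxx.
congr (_ + _)%E; rewrite integral_itv_obnd_cbnd//.
apply/measurable_EFinP; apply: measurable_funS mf => [|x]; last by right.
by apply: measurableU; exact: measurable_itv.
Qed.

(** Each piece contributes half a signed increment of [F]. An inner node belongs to two pieces of
    opposite sign, so its two halves add up to [F (u m)]. Nodes may coincide, which lets an inserted
    node fall on a zero. *)
Lemma integral_norm_alternating f F (u : nat -> R) (N : nat) :
  (forall m, (m <= N)%N -> u m <= u m.+1) ->
  {in `]u 0%N, u N.+1[, continuous f} ->
  {within `[u 0%N, u N.+1], continuous F} ->
  (forall x : R, x \in `]u 0%N, u N.+1[ -> is_derive x 1 F (- 2 * f x)) ->
  (forall m x, (m <= N)%N -> x \in `]u m, u m.+1[ -> 0 <= (-1) ^+ (m + N) * f x) ->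
  F (u 0%N) = 0 -> F (u N.+1) = 0 ->
  (\int[mu]_(x in `[u 0%N, u N.+1]) `|f x|%:E =
   (\sum_(1 <= m < N.+1) (-1) ^+ (m + N) * F (u m))%:E)%E.
Proof.
move=> u_le cf cF dF sgn F0 FN.
have u_mono := ler_nodes _ _ _ u_le.
have mf : measurable_fun `[u 0%N, u N.+1] (fun x => `|f x|).
  apply: measurableT_comp => //; apply: (@measurable_fun_itv_cc _ _ _ false true).
  by apply: open_continuous_measurable_fun => //; exact/in_continuous_mksetP.
pose s m : R := (-1) ^+ (m + N).
have piece m : (m <= N)%N -> (\int[mu]_(x in `[u m, u m.+1]) `|f x|%:E =
    (s m * ((F (u m) - F (u m.+1)) / 2))%:E)%E.
  move=> mN; have := u_le _ mN; rewrite le_eqVlt => /predU1P[<-|lt_u].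
    by rewrite subrr mul0r mulr0 set_itv1 integral_set1.
  have u0 : u 0%N <= u m by apply: u_mono; rewrite leq0n/= ltnW.
  have u1 : u m.+1 <= u N.+1 by apply: u_mono; rewrite !ltnS mN/=.
  have oo : {subset `]u m, u m.+1[ <= `]u 0%N, u N.+1[}.
    move=> x; rewrite !in_itv/= => /andP[p q].
    by rewrite (le_lt_trans u0 p) (lt_le_trans q u1).
  have cc : `[u m, u m.+1] `<=` `[u 0%N, u N.+1].
    move=> x; rewrite /= !in_itv/= => /andP[p q].
    by rewrite (le_trans u0 p) (le_trans q u1).
  transitivity (\int[mu]_(x in `[u m, u m.+1]) (s m * f x)%:E)%E.
    (* The sign of [f] is known only inside the piece, so the endpoints, a null set, are dropped
       before the absolute value is removed. *)
    rewrite [LHS]integral_itv_bndoo; last first.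
      apply/measurable_EFinP; apply: measurable_funS mf => // x.
      by move/oo; exact: subset_itv_oo_cc.
    rewrite [RHS]integral_itv_bndoo; last first.
      apply/measurable_EFinP; apply: measurable_funM => //.
      apply: open_continuous_measurable_fun => // x /set_mem/oo; exact: cf.
    apply: eq_integral => x /set_mem xm; congr (_%:E).
    by rewrite -[RHS]ger0_norm ?sgn// normrM /s normrX normrN1 expr1n mul1r.
  rewrite (@ge0_derivable_oo_FTC2 _ _ (fun x => - (s m / 2) * F x))//.
  - by congr (_%:E); field.
  - by move=> x; exact: sgn.
  - move=> x /oo xu; apply: cvgMr => //; exact: cf.
  - move=> x; apply: cvgMr; exact: (continuous_subspaceW cc cF).
  - move=> x /oo /dF h; apply: is_derive_eq.
    by rewrite /GRing.scale/=; field.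
have sums k : (k <= N.+1)%N -> (\int[mu]_(x in `[u 0%N, u k]) `|f x|%:E =
    (\sum_(m < k) s m * ((F (u m) - F (u m.+1)) / 2))%:E)%E.
  elim: k => [_|k IH kN]; first by rewrite big_ord0 set_itv1 integral_set1.
  rewrite big_ord_recr/= EFinD -IH ?(ltnW kN)// -piece//.
  apply: ge0_integral_itv_cat => //.
  - by apply: u_mono; rewrite leq0n ltnW.
  - exact: u_le.
  - apply: measurable_funS mf => //; apply: subset_itvl.
    by rewrite bnd_simp u_mono// kN/=.
rewrite sums//; congr (_%:E).
(* Summation by parts: [F0] and [FN] remove the extreme terms, and [s m.+1 = - s m] merges the two
   sums. *)
under eq_bigr do rewrite mulrA mulrBr mulrBl.
rewrite sumrB big_ord_recl big_ord_recr/= F0 FN !mulr0 !mul0r add0r addr0.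
rewrite big_add1/= big_mkord -sumrB; apply: eq_bigr => m _.
by rewrite /s /bump/= add1n addSn exprS; field.
Qed.

End alternating.

(** * Functional equation of the Gamma function *)

Section Gamma.
Context {R : realType}.
Notation mu := (@lebesgue_measure R).

(** The function is the [x]-th power of [s * expR (- (s / x))], and this base tends to 0 because
    [1 + y ^+ 2 / 2 <= expR y] at [y = s / x]. *)
Lemma powR_expRN_cvgy0 (x : R) : 0 < x -> s `^ x * expR (- s) @[s --> +oo] --> (0 : R).
Proof.
move=> x0.
have h : (s * expR (- (s / x))) `^ x @[s --> +oo] --> (0 : R).
  have : s * expR (- (s / x)) @[s --> +oo] --> (0 : R)^'+.
    move=> P [e /= e0 He].
    suff : \forall s \near +oo, P (s * expR (- (s / x))) by [].
    near=> s; have s0 : 0 < s by near: s; apply: nbhs_pinfty_gt; exact: num_real.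
    apply: He => /=; last by rewrite mulr_gt0 ?expR_gt0.
    rewrite sub0r normrN gtr0_norm ?mulr_gt0 ?expR_gt0//.
    have y0 : 0 < s / x by rewrite divr_gt0.
    rewrite expRN ltr_pdivrMr ?expR_gt0//.
    apply: (@lt_le_trans _ _ (e * (1 + (s / x) ^+ 2 / 2))); last first.
      by rewrite ler_pM2l//; exact: (expR_ge1Dxn 1 (ltW y0)).
    (* Past this threshold the quadratic term [e * (s / x) ^+ 2 / 2] alone exceeds [s]. *)
    have : 2 * x ^+ 2 / e < s by near: s; apply: nbhs_pinfty_gt; exact: num_real.
    rewrite ltr_pdivrMr// => hs.
    have -> : e * (1 + (s / x) ^+ 2 / 2) = e + s * (s * e) / (2 * x ^+ 2).
      by field; rewrite gt_eqF.
    apply: (@lt_trans _ _ (s * (s * e) / (2 * x ^+ 2))); last by rewrite ltrDr.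
    by rewrite ltr_pdivlMr ?mulr_gt0 ?exprn_gt0// ltr_pM2l.
  by move=> hlim; exact: (cvg_comp _ _ hlim (powR_cvg0 x0)).
apply: cvg_trans h; apply: near_eq_cvg; near=> s.
have s0 : 0 <= s by near: s; apply: nbhs_pinfty_ge; exact: num_real.
by rewrite powRM ?expR_ge0// -expRM mulNr divfK// gt_eqF.
Unshelve. all: by end_near. Qed.

Lemma is_derive_powR_expRN (x s : R) : 0 < s ->
  is_derive s 1 (fun s => s `^ x * expR (- s))
    (x * (s `^ (x - 1) * expR (- s)) - s `^ x * expR (- s)).
Proof.
move=> s0.
have := is_derive1_powR x s0 => h1.
have h2 : is_derive s 1 (fun s : R => expR (- s)) (expR (- s) * -1).
  exact: is_derive1_comp.
apply: is_derive_eq.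
by rewrite /GRing.scale/=; ring.
Qed.

Lemma powR_continuous_gt0 (x s : R) : 0 < s -> {for s, continuous (@powR R ^~ x)}.
Proof.
move=> s0; apply/differentiable_continuous/derivable1_diffP.
by apply: derivable_powR; rewrite in_itv/= s0.
Qed.

Lemma Gamma_ge0 (x : R) : 0 <= Gamma x.
Proof.
apply: fine_ge0; apply: integral_ge0 => s _.
by rewrite lee_fin mulr_ge0 ?powR_ge0 ?expR_ge0.
Qed.

Lemma powR_expRN_continuous_gt0 (x s : R) : 0 < s ->
  {for s, continuous (fun s : R => s `^ x * expR (- s))}.
Proof.
move=> /(is_derive_powR_expRN x)[? _].
exact/differentiable_continuous/derivable1_diffP.
Qed.

Lemma measurable_powR_expRN (x : R) (D : set R) :
  measurable_fun D (fun s : R => s `^ x * expR (- s)).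
Proof.
apply: measurable_funTS; apply: measurable_funM; first exact: measurable_powR.
by apply: measurableT_comp => //; exact: measurable_expR.
Qed.

(* The two sides differ by the integral of the derivative of
   [s `^ x * expR (- s)], whose sign changes only at [s = x]; splitting there
   avoids any finiteness assumption on the integrals. *)
Lemma Gamma_integralS (x : R) : 0 < x ->
  (\int[mu]_(s in `]0%R, +oo[) (s `^ x * expR (- s))%:E =
   x%:E * \int[mu]_(s in `]0%R, +oo[) (s `^ (x - 1) * expR (- s))%:E)%E.
Proof.
move=> x0.
pose v s : R := s `^ x * expR (- s).
pose w s : R := s `^ (x - 1) * expR (- s).
have v0 s : 0 <= v s by rewrite mulr_ge0 ?powR_ge0 ?expR_ge0.
have w0 s : 0 <= x * w s by rewrite !mulr_ge0 ?powR_ge0 ?expR_ge0 ?ltW.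
have vw s : 0 < s -> v s = s * w s.
  by move=> s0; rewrite /w mulrA mulr_powRB1// ltW.
have mv D : measurable_fun D v by exact: measurable_powR_expRN.
have mw D : measurable_fun D (fun s => x * w s).
  by apply: measurable_funM => //; exact: measurable_powR_expRN.
have cvw s : 0 < s -> {for s, continuous (fun s => x * w s - v s)}.
  move=> s0; apply: cvgB; last exact: powR_expRN_continuous_gt0.
  by apply: cvgMr; exact: powR_expRN_continuous_gt0.
(* Below [x] the derivative [x * w s - v s = (x - s) * w s] is nonnegative, and [v] climbs from 0 to
   [v x]. *)
have near0 : (\int[mu]_(s in `]0%R, x[) (x * w s)%:E =
              \int[mu]_(s in `]0%R, x[) (v s)%:E + (v x)%:E)%E.
  have d0 s : s \in `]0, x[ -> 0 <= x * w s - v s.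
    rewrite in_itv/= => /andP[s0 sx]; rewrite vw// -mulrBl.
    by rewrite mulr_ge0 ?subr_ge0 ?ltW// mulr_gt0 ?powR_gt0 ?expR_gt0.
  have <- : (\int[mu]_(s in `]0%R, x[) (x * w s - v s)%:E = (v x)%:E)%E.
    rewrite -(@integral_itv_bndoo _ 0 x _ true false); last first.
      by apply/measurable_EFinP; apply: measurable_funB; [exact: mw|exact: mv].
    rewrite (@ge0_derivable_oo_FTC2 _ _ v)//.
    - by rewrite {2}/v powR0 ?gt_eqF// mul0r subr0.
    - by move=> s; rewrite in_itv/= => /andP[s0 _]; exact: cvw.
    - apply/(continuous_within_itvP _ x0); split.
      + move=> s; rewrite in_itv/= => /andP[s0 _].
        exact: powR_expRN_continuous_gt0.
      + rewrite {2}/v powR0 ?gt_eqF// mul0r.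
        rewrite -[X in _ --> X](mul0r (expR (- 0))).
        apply: cvgM; first exact: powR_cvg0.
        apply: cvg_at_right_filter; apply: continuous_comp.
          exact: opp_continuous.
        exact: continuous_expR.
      + by apply: cvg_at_left_filter; exact: powR_expRN_continuous_gt0.
    - by move=> s; rewrite in_itv/= => /andP[s0 _]; exact: is_derive_powR_expRN.
  rewrite -ge0_integralD//=.
  - by apply: eq_integral => s _; rewrite -EFinD addrC subrK.
  - by move=> s _; rewrite lee_fin.
  - by apply/measurable_EFinP; exact: mv.
  - by apply/measurable_EFinP; apply: measurable_funB; [exact: mw|exact: mv].
(* Above [x], [v] falls from [v x] to 0: the same boundary term appears on the other side and
   cancels when the two parts are joined. *)
have nearoo : (\int[mu]_(s in `[x, +oo[) (v s)%:E =
              (v x)%:E + \int[mu]_(s in `[x, +oo[) (x * w s)%:E)%E.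
  have d0 s : x <= s -> 0 <= v s - x * w s.
    move=> xs; have s0 := lt_le_trans x0 xs; rewrite vw// -mulrBl.
    by rewrite mulr_ge0 ?subr_ge0 // mulr_ge0 ?powR_ge0 ?expR_ge0.
  have <- : (\int[mu]_(s in `[x, +oo[) (v s - x * w s)%:E = (v x)%:E)%E.
    rewrite (@ge0_continuous_FTC2y _ _ (fun s => - v s) x 0)//.
    - by rewrite -EFinB sub0r opprK.
    - apply: continuous_in_subspaceT => s /set_mem; rewrite /= in_itv/= andbT => xs.
      have s0 := lt_le_trans x0 xs.
      apply: cvgB; first exact: powR_expRN_continuous_gt0.
      by apply: cvgMr; exact: powR_expRN_continuous_gt0.
    - rewrite -[X in _ --> X]oppr0; apply: cvgN; exact: powR_expRN_cvgy0.
    - move=> s xs; apply: derivableN.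
      by have [] := is_derive_powR_expRN x s (lt_trans x0 xs).
    - apply: cvg_at_right_filter; apply: cvgN; exact: powR_expRN_continuous_gt0.
    - move=> s; rewrite in_itv/= andbT => xs.
      have h := is_derive_powR_expRN x s (lt_trans x0 xs).
      by rewrite derive1E deriveN ?derive_val ?opprB//; case: h.
  rewrite -ge0_integralD//=.
  - by apply: eq_integral => s _; rewrite -EFinD subrK.
  - by move=> s; rewrite in_itv/= andbT => /d0; rewrite lee_fin.
  - by apply/measurable_EFinP; apply: measurable_funB; [exact: mv|exact: mw].
  - by move=> s _; rewrite lee_fin.
  - by apply/measurable_EFinP; exact: mw.
rewrite -ge0_integralZl//=; last 3 first.
- by apply/measurable_EFinP; exact: measurable_powR_expRN.
- by move=> s _; rewrite lee_fin mulr_ge0 ?powR_ge0 ?expR_ge0.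
- by rewrite lee_fin ltW.
have -> : `]0, +oo[%classic = `]0, x[%classic `|` `[x, +oo[%classic :> set R.
  by rewrite -itv_bndbnd_setU.
have dis : [disjoint `]0, x[%classic & `[x, +oo[%classic : set R].
  apply/disj_setPS => s /=; rewrite !in_itv/= andbT => -[/andP[_ sx] xs].
  by move: (lt_le_trans sx xs); rewrite ltxx.
rewrite !ge0_integral_setU//=.
- by move: near0 nearoo; rewrite /v /w => E0 E1; rewrite E1 addeA -E0.
- by apply/measurable_EFinP; exact: mw.
- by move=> s _; rewrite lee_fin; exact: w0.
- by apply/measurable_EFinP; exact: mv.
- by move=> s _; rewrite lee_fin; exact: v0.
Qed.

Lemma GammaS (x : R) : 0 < x -> Gamma (x + 1) = x * Gamma x.
Proof.
move=> x0; rewrite /Gamma addrK Gamma_integralS//.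
(* [fine] sends an infinite value to 0, and a positive multiple of an infinite value is infinite, so
   both sides are 0 in the last two cases. *)
case: (integral _ _ _) => [r| |] //=.
- by rewrite gt0_muley ?lte_fin// mulr0.
- by rewrite gt0_muleNy ?lte_fin// mulr0.
Qed.

End Gamma.

(** * Derivative of the weighted Jacobi polynomials *)

Section Jacobi.
Context {R : realType}.
Implicit Types (a b x : R) (n i j k : nat).

Definition jacobi_coef n a b j : R :=
  (2 ^+ n)^-1 * gbinom (n%:R + a) (n - j) * gbinom (n%:R + b) j.

(** A formal polynomial, so that root counting and factorization apply. *)
Definition jacobi_poly n a b : {poly R} :=
  \sum_(j < n.+1) jacobi_coef n a b j *: (('X - 1%:P) ^+ j * ('X + 1%:P) ^+ (n - j)).

Definition weighted_jacobiP n a b x : R :=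
  (1 - x) `^ a * (1 + x) `^ b * jacobiP n a b x.

Lemma horner_jacobi_poly n a b x : (jacobi_poly n a b).[x] = jacobiP n a b x.
Proof.
rewrite /jacobi_poly /jacobiP horner_sum; apply: eq_bigr => j _.
by rewrite hornerZ hornerM !horner_exp !(hornerD, hornerN, hornerX, hornerC) mulrA.
Qed.

Lemma gbinomS (y : R) k : k.+1%:R * gbinom y k.+1 = (y - k%:R) * gbinom y k.
Proof.
rewrite /gbinom big_ord_recr/= factS natrM.
have : k.+1%:R != 0 :> R by rewrite pnatr_eq0.
have : k`!%:R != 0 :> R by rewrite pnatr_eq0 -lt0n fact_gt0.
move: (k.+1%:R) (k`!%:R) => c d d0 c0.
by field; rewrite d0 c0.
Qed.

(** Up to the sign [(-1) ^+ j], this is the derivative of [(1 - x)^(a+1+j) (1 + x)^(b+1+l)] divided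
    by [(1 - x)^a (1 + x)^b]. *)
Lemma jacobi_poly_term_deriv a b x j l :
  (1 - x) * (1 + x) * (('X - 1%:P) ^+ j * ('X + 1%:P) ^+ l)^`().[x]
  + ((b + 1) * (1 - x) - (a + 1) * (1 + x)) * ((x - 1) ^+ j * (x + 1) ^+ l)
  = - ((a + 1 + j%:R) * ((x - 1) ^+ j * (x + 1) ^+ l.+1)
       + (b + 1 + l%:R) * ((x - 1) ^+ j.+1 * (x + 1) ^+ l)).
Proof.
rewrite derivM !deriv_exp !derivD !derivN derivX !derivC.
(* Zero exponents are treated apart, because differentiating a power produces the predecessors
   [j.-1] and [l.-1]. *)
case: j l => [|j] [|l]; rewrite ?mulr0n ?addr0 ?subr0 ?oppr0 ?mul1r /= ?(mulr0, mul0r, addr0) ?(hornerD, hornerN, hornerM, hornerMn, horner_exp, hornerX, hornerC) ?exprS ?expr0.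
all: ring.
Qed.

(** Since [a + 1 + j = n.+1 + a - (n - j)], the left factor is the one that [gbinomS] absorbs when
    it raises the lower index [n - j]; the 2 comes from [2 ^+ n.+1]. *)
Lemma jacobi_coef_stepl n a b j : (j <= n)%N ->
  (a + 1 + j%:R) * jacobi_coef n (a + 1) (b + 1) j =
  2 * (n.+1 - j)%:R * jacobi_coef n.+1 a b j.
Proof.
move=> jn; have shift y : n%:R + (y + 1) = n.+1%:R + y :> R by rewrite -natr1; ring.
rewrite /jacobi_coef !shift subSn//.
have := gbinomS (n.+1%:R + a) (n - j).
rewrite (_ : n.+1%:R + a - _ = a + 1 + j%:R); last by rewrite natrB// -natr1; ring.
move=> E; rewrite exprS invfM.
transitivity ((2 ^+ n)^-1 * ((a + 1 + j%:R) * gbinom (n.+1%:R + a) (n - j))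
  * gbinom (n.+1%:R + b) j); first by ring.
by rewrite -E; field; rewrite expf_neq0// pnatr_eq0.
Qed.

Lemma jacobi_coef_stepr n a b j : (j <= n)%N ->
  (b + 1 + (n - j)%:R) * jacobi_coef n (a + 1) (b + 1) j =
  2 * j.+1%:R * jacobi_coef n.+1 a b j.+1.
Proof.
move=> jn; have shift y : n%:R + (y + 1) = n.+1%:R + y :> R by rewrite -natr1; ring.
rewrite /jacobi_coef !shift subSS.
have := gbinomS (n.+1%:R + b) j.
rewrite (_ : n.+1%:R + b - _ = b + 1 + (n - j)%:R); last first.
  by rewrite natrB// -natr1; ring.
move=> E; rewrite exprS invfM.
transitivity ((2 ^+ n)^-1 * gbinom (n.+1%:R + a) (n - j) *
  ((b + 1 + (n - j)%:R) * gbinom (n.+1%:R + b) j)); first by ring.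
by rewrite -E; field; rewrite expf_neq0// pnatr_eq0.
Qed.

(** The derivative formula for the weighted polynomial with the common factor [(1 - x)^a (1 + x)^b]
    divided out, which leaves an identity between polynomials. *)
Lemma jacobi_poly_deriv n a b x :
  (1 - x) * (1 + x) * (jacobi_poly n (a + 1) (b + 1))^`().[x]
  + ((b + 1) * (1 - x) - (a + 1) * (1 + x)) * jacobiP n (a + 1) (b + 1) x
  = - 2 * n.+1%:R * jacobiP n.+1 a b x.
Proof.
pose T j := jacobi_coef n.+1 a b j * ((x - 1) ^+ j * (x + 1) ^+ (n.+1 - j)).
have -> : jacobiP n.+1 a b x = \sum_(j < n.+2) T j.
  by apply: eq_bigr => j _; rewrite /T /jacobi_coef !mulrA.
rewrite -(horner_jacobi_poly n) /jacobi_poly raddf_sum/= !horner_sum !mulr_sumr -big_split/=.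
transitivity (\sum_(j < n.+1) (- 2 * (n.+1 - j)%:R * T j - 2 * j.+1%:R * T j.+1)).
  apply: eq_bigr => j _; have jn : (j <= n)%N by rewrite -ltnS.
  rewrite derivZ !hornerZ.
  rewrite (hornerM (('X - 1%:P) ^+ j)) !horner_exp !(hornerD, hornerN, hornerX, hornerC).
  set C := jacobi_coef _ _ _ _; set d := _.[x].
  transitivity (C * ((1 - x) * (1 + x) * d +
    ((b + 1) * (1 - x) - (a + 1) * (1 + x)) * ((x - 1) ^+ j * (x + 1) ^+ (n - j)))).
    by ring.
  rewrite jacobi_poly_term_deriv -subSn//.
  transitivity (- ((a + 1 + j%:R) * C * ((x - 1) ^+ j * (x + 1) ^+ (n.+1 - j)))
     - (b + 1 + (n - j)%:R) * C * ((x - 1) ^+ j.+1 * (x + 1) ^+ (n - j))).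
    by ring.
  by rewrite jacobi_coef_stepl// jacobi_coef_stepr// /T subSS; ring.
rewrite sumrB.
(* Both sums are extended to [j < n.+2] by a term with factor 0; then [(n.+1 - j) + j = n.+1] merges
   them. *)
have -> : \sum_(j < n.+1) - 2 * (n.+1 - j)%:R * T j =
          \sum_(j < n.+2) - 2 * (n.+1 - j)%:R * T j.
  by rewrite [RHS]big_ord_recr/= subnn mulr0 mul0r addr0.
have -> : \sum_(j < n.+1) 2 * j.+1%:R * T j.+1 = \sum_(j < n.+2) 2 * j%:R * T j.
  by rewrite [RHS]big_ord_recl/= mulr0 mul0r add0r.
rewrite -sumrB; apply: eq_bigr => j _.
by rewrite natrB -1?ltnS//; ring.
Qed.

Lemma is_derive_weighted_jacobiP n a b x : -1 < x < 1 ->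
  is_derive x 1 (weighted_jacobiP n (a + 1) (b + 1))
    (- 2 * n.+1%:R * weighted_jacobiP n.+1 a b x).
Proof.
move=> /andP[x1 x2].
have y0 : 0 < 1 - x by rewrite subr_gt0.
have z0 : 0 < 1 + x by rewrite -ltrBlDl sub0r.
have hy : is_derive x 1 (fun x => (1 - x) `^ (a + 1)) ((a + 1) * (1 - x) `^ a * -1).
  have := is_derive1_powR (a + 1) y0; rewrite addrK => h.
  apply: (@is_derive1_comp _ (@powR R ^~ (a + 1)) (fun x => 1 - x)).
  by apply: is_derive_eq; ring.
have hz : is_derive x 1 (fun x => (1 + x) `^ (b + 1)) ((b + 1) * (1 + x) `^ b * 1).
  have := is_derive1_powR (b + 1) z0; rewrite addrK => h.
  apply: (@is_derive1_comp _ (@powR R ^~ (b + 1)) (fun x => 1 + x)).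
  by apply: is_derive_eq; ring.
have hp : is_derive x 1 (jacobiP n (a + 1) (b + 1)) (jacobi_poly n (a + 1) (b + 1))^`().[x].
  rewrite (_ : jacobiP _ _ _ = horner (jacobi_poly n (a + 1) (b + 1))).
    exact: is_derive_poly.
  by apply/funext => z; rewrite horner_jacobi_poly.
apply: is_derive_eq.
rewrite /weighted_jacobiP mulrCA -jacobi_poly_deriv /GRing.scale/=.
have powS (c y : R) : 0 < y -> y `^ (c + 1) = y * y `^ c.
  by move=> c0; rewrite powRD ?powRr1 ?ltW ?(gt_eqF c0) ?implybT// mulrC.
rewrite !powS//; ring.
Qed.

End Jacobi.

(** * Zeros and sign changes of the Jacobi polynomials *)

Section JacobiZeros.
Context {R : realType}.
Implicit Types (a b x : R) (n i j k : nat).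

Lemma derivable_weighted_jacobiP n a b x : -1 < x < 1 ->
  derivable (weighted_jacobiP n a b) x 1.
Proof.
move=> x1; rewrite -(subrK 1 a) -(subrK 1 b).
by have [] := is_derive_weighted_jacobiP n (a - 1) (b - 1) x x1.
Qed.

Lemma cvg_powR_1B a : 0 < a -> (1 - x) `^ a @[x --> 1^'-] --> (0 : R).
Proof.
move=> a0; have h : 1 - x @[x --> (1 : R)^'-] --> (0 : R)^'+.
  move=> P [e /= e0 He]; exists e => //= y y1 y2; apply: He => /=.
    by rewrite sub0r normrN.
  by rewrite subr_gt0.
exact: (cvg_comp _ _ h (powR_cvg0 a0)).
Qed.

Lemma cvg_powR_1D a : 0 < a -> (1 + x) `^ a @[x --> (-1)^'+] --> (0 : R).
Proof.
move=> a0; have h : 1 + x @[x --> (-1 : R)^'+] --> (0 : R)^'+.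
  move=> P [e /= e0 He]; exists e => //= y y1 y2; apply: He => /=.
    by rewrite sub0r opprD.
  by rewrite -ltrBlDl sub0r.
exact: (cvg_comp _ _ h (powR_cvg0 a0)).
Qed.

Lemma continuous_jacobiP n a b : continuous (jacobiP n a b).
Proof.
rewrite (_ : jacobiP _ _ _ = horner (jacobi_poly n a b)).
  exact: continuous_horner.
by apply/funext => z; rewrite horner_jacobi_poly.
Qed.

Lemma weighted_jacobiP1 n a b : 0 < a -> weighted_jacobiP n a b 1 = 0.
Proof. by move=> a0; rewrite /weighted_jacobiP subrr powR0 ?gt_eqF// !mul0r. Qed.

Lemma weighted_jacobiPN1 n a b : 0 < b -> weighted_jacobiP n a b (-1) = 0.
Proof. by move=> b0; rewrite /weighted_jacobiP subrr powR0 ?gt_eqF// mulr0 mul0r. Qed.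

(** At -1 and 1 a weight factor with positive exponent tends to 0, which is also its value there. *)
Lemma continuous_weighted_jacobiP n a b : 0 < a -> 0 < b ->
  {within `[-1, 1], continuous (weighted_jacobiP n a b)}.
Proof.
move=> a0 b0; have ltN11 : -1 < 1 :> R by lra.
apply/(continuous_within_itvP _ ltN11); split.
- move=> x; rewrite in_itv/= => x1.
  exact/differentiable_continuous/derivable1_diffP/derivable_weighted_jacobiP.
- rewrite weighted_jacobiPN1// -[X in _ --> X](mul0r (jacobiP n a b (-1))).
  apply: cvgM; last by apply: cvg_at_right_filter; exact: continuous_jacobiP.
  rewrite -[X in _ --> X](mulr0 ((1 - -1) `^ a)).
  apply: cvgM; last exact: cvg_powR_1D.
  apply: cvg_at_right_filter.
  apply: (@continuous_comp _ _ _ (fun x : R => 1 - x) (@powR R ^~ a)).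
    by apply: cvgB; [exact: cvg_cst|exact: cvg_id].
  by apply: powR_continuous_gt0; lra.
- rewrite weighted_jacobiP1// -[X in _ --> X](mul0r (jacobiP n a b 1)).
  apply: cvgM; last by apply: cvg_at_left_filter; exact: continuous_jacobiP.
  rewrite -[X in _ --> X](mul0r ((1 + 1) `^ b)).
  apply: cvgM; first exact: cvg_powR_1B.
  apply: cvg_at_left_filter.
  apply: (@continuous_comp _ _ _ (fun x : R => 1 + x) (@powR R ^~ b)).
    by apply: cvgD; [exact: cvg_cst|exact: cvg_id].
  by apply: powR_continuous_gt0; lra.
Qed.

(** Rolle's theorem between consecutive members of a sorted list. Derivability is asked only inside,
    since a weight may fail to be differentiable at -1 and 1. *)
Lemma Rolle_path (F : R -> R) (l r x : R) (s : seq R) :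
  {within `[l, r], continuous F} ->
  (forall y, l < y < r -> derivable F y 1) ->
  path <%R x s -> {in x :: s, forall y, l <= y <= r} ->
  {in x :: s, forall y, F y = 0} ->
  exists s', [/\ size s' = size s, path <%R x s', {in s', forall y, l < y < r}
                & {in s', forall y, 'D_1 F y = 0}].
Proof.
move=> cF dF; elim: s x => [|y s IH] x /= xs lr F0; first by exists [::].
case/andP: xs => xy ys.
have /andP[lx xr] := lr x (mem_head _ _).
have yin : y \in [:: x, y & s] by rewrite !inE eqxx orbT.
have /andP[ly yr] := lr y yin.
have [c cxy dc] : exists2 c, c \in `]x, y[ & is_derive c 1 F 0.
  apply: Rolle => //.
  - move=> z; rewrite in_itv/= => /andP[xz zy]; apply: dF.
    by rewrite (le_lt_trans lx) ?(lt_le_trans zy).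
  - apply: continuous_subspaceW cF => z; rewrite /= !in_itv/= => /andP[xz zy].
    by rewrite (le_trans lx) ?(le_trans zy).
  - by rewrite !F0 ?mem_head.
move: cxy; rewrite in_itv/= => /andP[xc cy].
have [||s' [ss' ys' lr' D0]] := IH y ys.
- by move=> z zs; apply: lr; rewrite inE zs orbT.
- by move=> z zs; apply: F0; rewrite inE zs orbT.
exists (c :: s'); split => /=; first by rewrite ss'.
- by rewrite xc/=; exact: (path_le lt_trans cy ys').
- move=> z; rewrite inE => /predU1P[->|/lr'//].
  by rewrite (le_lt_trans lx xc) (lt_le_trans cy yr).
- by move=> z; rewrite inE => /predU1P[->|/D0//]; rewrite derive_val.
Qed.

(* Rolle's theorem applied to [weighted_jacobiP n (a + 1) (b + 1)], which also
   vanishes at the endpoints, yields one more zero for its derivative. *)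
Lemma jacobiP_zeros n a b : -1 < a -> -1 < b ->
  exists s : seq R, [/\ size s = n, path <%R (-1) s,
    {in s, forall y, -1 < y < 1} & {in s, forall y, jacobiP n a b y = 0}].
Proof.
elim: n a b => [|n IH] a b a1 b1; first by exists [::].
have a2 : 0 < a + 1 by lra.
have b2 : 0 < b + 1 by lra.
have [||s [ss ps s1 P0]] := IH (a + 1) (b + 1); [lra|lra|].
have := @Rolle_path (weighted_jacobiP n (a + 1) (b + 1)) (-1) 1 (-1) (rcons s 1).
case.
- exact: continuous_weighted_jacobiP.
- by move=> y; exact: derivable_weighted_jacobiP.
- rewrite rcons_path ps/=; have := mem_last (-1) s.
  by rewrite inE => /predU1P[->|/s1/andP[]//]; lra.
- move=> y; rewrite inE mem_rcons inE => /or3P[/eqP->|/eqP->|/s1]; lra.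
- move=> y; rewrite inE mem_rcons inE => /or3P[/eqP->|/eqP->|/P0].
  + exact: weighted_jacobiPN1.
  + exact: weighted_jacobiP1.
  + by rewrite /weighted_jacobiP => ->; rewrite mulr0.
move=> s' [ss' ps' s1' D0]; exists s'; split => //.
  by rewrite ss' size_rcons ss.
move=> y ys; have y1 := s1' y ys.
have h := is_derive_weighted_jacobiP n a b y y1.
have := D0 y ys; rewrite derive_val /weighted_jacobiP => /eqP.
have /andP[y2 y3] := y1.
(* Inside (-1, 1) both weight factors are positive, so a zero of the derivative is a zero of
   [jacobiP n.+1 a b]. *)
rewrite !mulf_eq0 oppr_eq0 !pnatr_eq0/= => /orP[/orP[]|/eqP//].
- by rewrite gt_eqF// powR_gt0//; lra.
- by rewrite gt_eqF// powR_gt0//; lra.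
Qed.

Lemma size_jacobi_poly n a b : (size (jacobi_poly n a b) <= n.+1)%N.
Proof.
apply: (leq_trans (size_sum _ _ _)); apply/bigmax_leqP => j _.
apply: (leq_trans (size_scale_leq _ _)); apply: (leq_trans (size_polyMleq _ _)).
have -> : 'X + 1%:P = 'X - (-1)%:P :> {poly R} by rewrite polyCN opprK.
rewrite !size_exp_XsubC addSn/= addnS subnKC// -ltnS//.
Qed.

(** At 1 only the summand [j = 0] survives, and the factors [n + a - l] of its binomial, with
    [l < n], are positive. *)
Lemma jacobiP1_gt0 n a b : -1 < a -> 0 < jacobiP n a b 1.
Proof.
move=> a1; rewrite /jacobiP big_ord_recl big1 => [|j _]; last first.
  by rewrite subrr exprS mul0r !(mulr0, mul0r).
have gbinom0 (y : R) : gbinom y 0 = 1 by rewrite /gbinom big_ord0 fact0 divr1.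
rewrite /= addr0 subn0 gbinom0 expr0 !mulr1 /gbinom.
rewrite !mulr_gt0 ?invr_gt0 ?exprn_gt0 ?ltr0n ?fact_gt0//.
apply: prodr_gt0 => l _.
have : l%:R + 1 <= n%:R :> R by rewrite natr1 ler_nat.
lra.
Qed.

(** The [n] zeros from [jacobiP_zeros] exhaust the degree, so every [t m] is one of them. The [t m]
    are themselves [n] distinct roots and give the full factorization. *)
Lemma jacobiP_factorization n a b (t : nat -> R) : -1 < a -> -1 < b ->
  (forall m, (1 <= m <= n)%N -> jacobiP n a b (t m) = 0) ->
  (forall m, (1 <= m < n)%N -> t m < t m.+1) ->
  (forall m, (1 <= m <= n)%N -> -1 < t m < 1) /\
  exists2 c : R, 0 < c & forall x, jacobiP n a b x = c * \prod_(1 <= m < n.+1) (x - t m).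
Proof.
move=> a1 b1 t0 t_lt.
have [s [ss ps s1 P0]] := jacobiP_zeros n a b a1 b1.
have rootP y : root (jacobi_poly n a b) y = (jacobiP n a b y == 0).
  by rewrite rootE horner_jacobi_poly.
have p0 : jacobi_poly n a b != 0.
  apply/eqP => p0; have := jacobiP1_gt0 n a b a1.
  by rewrite -horner_jacobi_poly p0 horner0 ltxx.
have tin m : (1 <= m <= n)%N -> -1 < t m < 1.
  move=> mn; apply: s1; apply/negPn/negP => tms.
  (* Otherwise [t m :: s] would list [n.+1] distinct roots of a nonzero polynomial of degree at most
     [n]. *)
  have := @max_poly_roots _ (jacobi_poly n a b) (t m :: s) p0.
  have /= -> : root (jacobi_poly n a b) (t m) by rewrite rootP t0.
  rewrite tms (sorted_uniq lt_trans ltxx (path_sorted ps)) ss.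
  have -> : all (root (jacobi_poly n a b)) s by apply/allP => y /P0; rewrite rootP => ->.
  by move=> /(_ isT isT); rewrite ltnNge size_jacobi_poly.
split=> //.
pose ts := [seq t m | m <- index_iota 1 n.+1].
have tsr : all (root (jacobi_poly n a b)) ts.
  apply/allP => _ /mapP[m + ->]; rewrite mem_index_iota ltnS => mn.
  by rewrite rootP t0.
have tsu : uniq ts.
  have tmono j k : (1 <= j)%N -> (j < k <= n)%N -> t j < t k.
    move=> j1; elim: k => [//|k IH]; rewrite ltnS leq_eqVlt => /andP[/predU1P[<- jn|jk kn]].
      by apply: t_lt; rewrite j1.
    apply: (lt_trans (IH _)); first by rewrite jk ltnW.
    by apply: t_lt; rewrite kn andbT (leq_trans j1 (ltnW jk)).
  rewrite map_inj_in_uniq ?iota_uniq// => j k.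
  rewrite !mem_index_iota !ltnS => /andP[j1 jn] /andP[k1 kn] tjk.
  case: (ltngtP j k) => // jk.
    by have := tmono _ _ j1 (introT andP (conj jk kn)); rewrite tjk ltxx.
  by have := tmono _ _ k1 (introT andP (conj jk jn)); rewrite tjk ltxx.
have tss : size ts = n by rewrite size_map size_iota subn1.
have psz : size (jacobi_poly n a b) = (size ts).+1.
  apply/eqP; rewrite eqn_leq tss size_jacobi_poly/=.
  by have := max_poly_roots p0 tsr tsu; rewrite tss.
have pE x : jacobiP n a b x = lead_coef (jacobi_poly n a b) * \prod_(1 <= m < n.+1) (x - t m).
  rewrite -horner_jacobi_poly.
  rewrite {1}(all_roots_prod_XsubC psz tsr) ?uniq_rootsE//.
  rewrite hornerZ horner_prod big_map; congr (_ * _).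
  by apply: eq_bigr => m _; rewrite hornerXsubC.
exists (lead_coef (jacobi_poly n a b)) => //.
(* At 1 all factors [1 - t m] are positive, so the leading coefficient has the sign of the value
   there. *)
have := jacobiP1_gt0 n a b a1; rewrite pE pmulr_lgt0// big_nat.
by apply: prodr_gt0 => m /andP[m1 mn]; have := tin m; rewrite m1 -ltnS mn subr_gt0 => /(_ isT)/andP[].
Qed.

Lemma prod_subr_sign (t : nat -> R) n m x : (m <= n)%N ->
  (forall k, (1 <= k <= m)%N -> t k <= x) ->
  (forall k, (m < k <= n)%N -> x <= t k) ->
  0 <= (-1) ^+ (m + n) * \prod_(1 <= k < n.+1) (x - t k).
Proof.
move=> mn lo hi; rewrite (big_cat_nat (n := m.+1))//= mulrCA mulr_ge0//.
  rewrite big_nat; apply: prodr_ge0 => k; rewrite ltnS => /lo.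
  by rewrite subr_ge0.
(* Flipping the last [n - m] factors contributes [(-1) ^+ (n - m)], and [(m + n) + (n - m) = 2 * n]
   is even. *)
rewrite (eq_bigr (fun k => -1 * (t k - x))) => [|k _]; last by rewrite mulN1r opprB.
rewrite big_split/= prodr_const_nat subSS mulrA -exprD addnAC subnKC// addnn.
rewrite -mul2n exprM sqrrN expr1n expr1n mul1r.
rewrite big_nat; apply: prodr_ge0 => k; rewrite ltnS => /hi.
by rewrite subr_ge0.
Qed.

End JacobiZeros.

(** * Jacobi functions and the primitive of their moments *)

Section JacobiFunctions.
Context {R : realType}.
Implicit Types (a b x : R) (n i j k : nat).

Definition jacobip_coef n a b : R :=
  (2 * n%:R + a + b + 1) * Gamma (n%:R + a + b + 1) * (n`!)%:R
  / (2 `^ (a + b + 1) * Gamma (n%:R + a + 1) * Gamma (n%:R + b + 1)).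

Lemma jacobipE n a b x :
  jacobip n a b x = jacobip_coef n a b * weighted_jacobiP n a b x.
Proof. by rewrite /jacobip /weighted_jacobiP !mulrA. Qed.

(** Three ingredients differ between the sides: [GammaS] supplies [n.+1 + a + b + 1], the factorial
    supplies [n.+1], and the power of 2 a quarter. *)
Lemma jacobip_coef_step n a b : 0 < n.+1%:R + a + b + 1 ->
  jacobip_coef n (a + 1) (b + 1) * (2 * n.+1%:R) =
  (n.+1%:R + a + b + 1) / 2 * jacobip_coef n.+1 a b.
Proof.
move=> M0; rewrite /jacobip_coef.
have -> : n%:R + (a + 1) + (b + 1) + 1 = (n.+1%:R + a + b + 1) + 1.
  by rewrite -natr1; ring.
have -> : n%:R + (a + 1) + 1 = n.+1%:R + a + 1 by rewrite -natr1; ring.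
have -> : n%:R + (b + 1) + 1 = n.+1%:R + b + 1 by rewrite -natr1; ring.
have -> : 2 * n%:R + (a + 1) + (b + 1) + 1 = 2 * n.+1%:R + a + b + 1.
  by rewrite -natr1; ring.
have -> : 2 `^ (a + 1 + (b + 1) + 1) = 4 * 2 `^ (a + b + 1) :> R.
  rewrite (_ : a + 1 + (b + 1) + 1 = a + b + 1 + 2%:R); last by ring.
  rewrite powRD ?pnatr_eq0 ?implybT// powR_mulrn ?ler0n// mulrC; congr (_ * _).
  by ring.
rewrite GammaS// factS natrM !invfM.
set g1 := (Gamma (n.+1%:R + a + 1))^-1; set g2 := (Gamma (n.+1%:R + b + 1))^-1.
set p := (2 `^ (a + b + 1))^-1.
by field.
Qed.

Lemma jacobip_coef_ge0 n a b : 0 <= 2 * n%:R + a + b + 1 -> 0 <= jacobip_coef n a b.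
Proof.
move=> h; rewrite /jacobip_coef.
by rewrite !(mulr_ge0, invr_ge0, powR_ge0, Gamma_ge0)// ler0n.
Qed.

Lemma is_derive_jacobip n a b x : 0 < n.+1%:R + a + b + 1 -> -1 < x < 1 ->
  is_derive x 1 (jacobip n (a + 1) (b + 1))
    (- ((n.+1%:R + a + b + 1) / 2 * jacobip n.+1 a b x)).
Proof.
move=> M0 x1; have h := is_derive_weighted_jacobiP n a b x x1.
rewrite (funext (jacobipE n (a + 1) (b + 1))).
apply: is_derive_eq; rewrite /GRing.scale/= jacobipE [in RHS]mulrA.
by rewrite -jacobip_coef_step//; ring.
Qed.

(** The exponent 0 is a separate case: the predecessor in [nat] would give 1 there instead of 0. *)
Lemma is_derive_expr_fact i x :
  is_derive x 1 (fun x : R => x ^+ i / i`!%:R)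
    (if i is i'.+1 then x ^+ i' / i'`!%:R else 0 : R).
Proof.
case: i => [|i].
  have -> : (fun x : R => x ^+ 0 / 0`!%:R) = cst 1.
    by apply/funext => y; rewrite expr0 fact0 divr1.
  exact: is_derive_cst.
have -> : (fun x : R => x ^+ i.+1 / i.+1`!%:R) = i.+1`!%:R^-1 *: (@id R) ^+ i.+1.
  by apply/funext => y; rewrite fctE mulrC.
apply: is_derive_eq; rewrite /GRing.scale/=.
have : i.+1%:R != 0 :> R by rewrite pnatr_eq0.
have : i`!%:R != 0 :> R by rewrite pnatr_eq0 -lt0n fact_gt0.
rewrite factS natrM; move: (i.+1%:R) (i`!%:R) => c d d0 c0.
by field; rewrite d0 c0.
Qed.

(** The quantity [A m] of the theorem with a free variable in place of [t m]. *)
Definition moment_primitive n i a b x : R :=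
  \sum_(k < i.+1)
      (2 ^+ (k + 2) * Gamma (n%:R + a + b + 1) / Gamma (n%:R + k%:R + a + b + 2))
      * (x ^+ (i - k) / ((i - k)`!)%:R)
      * jacobip (n - 1 - k) (a + 1 + k%:R) (b + 1 + k%:R) x.

(* Repeated integration by parts: the derivative of the [k]-th summand is the
   difference of consecutive terms of [e], so the sum telescopes. *)
Lemma is_derive_moment_primitive n i a b x :
  (i < n)%N -> -1 < a -> -1 < b -> -1 < x < 1 ->
  is_derive x 1 (moment_primitive n i a b) (- 2 * (x ^+ i / i`!%:R * jacobip n a b x)).
Proof.
move=> i_n a1 b1 x1.
have n1 : 1 <= n%:R :> R by rewrite ler1n (leq_ltn_trans _ i_n).
pose G := Gamma (n%:R + a + b + 1).
pose e k := 2 ^+ k.+1 * G / Gamma (n%:R + a + b + 1 + k%:R)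
  * (x ^+ (i - k) / (i - k)`!%:R) * jacobip (n - k) (a + k%:R) (b + k%:R) x.
(* The cut-off matters at [i.+1]: the last power is constant and has derivative 0, whereas
   [i - i.+1] is 0 in [nat], so [e i.+1] need not vanish. *)
pose E k := if (k <= i)%N then e k else 0.
have dterm (k : 'I_i.+1) : is_derive x 1 (fun x =>
      (2 ^+ (k + 2) * Gamma (n%:R + a + b + 1) / Gamma (n%:R + k%:R + a + b + 2))
      * (x ^+ (i - k) / ((i - k)`!)%:R)
      * jacobip (n - 1 - k) (a + 1 + k%:R) (b + 1 + k%:R) x) (E k.+1 - E k).
  case: k => k /=; rewrite ltnS => ki.
  have kn : (k < n)%N by exact: leq_ltn_trans i_n.
  have nkE : (n - k = (n - 1 - k).+1)%N by rewrite subnAC subn1 prednK// subn_gt0.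
  have k0 : 0 <= k%:R :> R by rewrite ler0n.
  have ME : (n - 1 - k).+1%:R + (a + k%:R) + (b + k%:R) + 1 = n%:R + a + b + 1 + k%:R.
    by rewrite -nkE natrB ?(ltnW kn)//; ring.
  have M0 : 0 < n%:R + a + b + 1 + k%:R by lra.
  have hp : is_derive x 1 (jacobip (n - 1 - k) (a + 1 + k%:R) (b + 1 + k%:R))
      (- ((n%:R + a + b + 1 + k%:R) / 2 * jacobip (n - k) (a + k%:R) (b + k%:R) x)).
    by rewrite nkE -ME !(addrAC _ 1 k%:R); apply: is_derive_jacobip; rewrite // ME.
  have hx := is_derive_expr_fact (i - k) x.
  have -> : n%:R + k%:R + a + b + 2 = n%:R + a + b + 1 + k%:R + 1 by ring.
  (* The factor [(n + a + b + 1 + k) / 2] from [hp] cancels against [GammaS] and lowers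
     [2 ^+ (k + 2)] to [2 ^+ k.+1], which leaves [- E k]. *)
  apply: is_derive_eq; rewrite /GRing.scale/= /E ki /e (GammaS _ M0).
  have -> : n%:R + a + b + 1 + k.+1%:R = n%:R + a + b + 1 + k%:R + 1.
    by rewrite -natr1; ring.
  rewrite (GammaS _ M0) invfM -/G.
  have <- : jacobip (n - 1 - k) (a + 1 + k%:R) (b + 1 + k%:R) x
      = jacobip (n - k.+1) (a + k.+1%:R) (b + k.+1%:R) x.
    by rewrite -subnDA add1n -!natr1 !addrA !(addrAC _ 1).
  set g := (Gamma _)^-1; set q := jacobip _ _ _ _; set q' := jacobip _ _ _ _.
  set M := n%:R + a + b + 1 + k%:R in M0 *; have M1 : M != 0 by rewrite gt_eqF.
  rewrite addn2 (exprS _ k.+1).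
  rewrite subnS -subn_gt0; case: (i - k)%N => [|l] /=.
    by rewrite fact0 expr0; field.
  set u := _ / l`!%:R; set v := _ / l.+1`!%:R.
  by field.
rewrite (_ : moment_primitive n i a b = \sum_(k < i.+1) (fun x =>
      (2 ^+ (k + 2) * Gamma (n%:R + a + b + 1) / Gamma (n%:R + k%:R + a + b + 2))
      * (x ^+ (i - k) / ((i - k)`!)%:R)
      * jacobip (n - 1 - k) (a + 1 + k%:R) (b + 1 + k%:R) x)); last first.
  by apply/funext => z; rewrite fct_sumE.
apply: is_derive_eq.
rewrite -(big_mkord xpredT (fun k => E k.+1 - E k)) telescope_sumr// /E ltnn/= sub0r.
rewrite /e !addr0 !subn0 expr1 -/G.
(* If [G = 0] then [jacobip n a b] is zero too, so that positivity of [Gamma] is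
   never needed. *)
have [G0|G0] := eqVneq G 0; last by rewrite mulfK//; ring.
by rewrite jacobipE /jacobip_coef -/G G0 !(mulr0, mul0r) oppr0.
Qed.

Lemma moment_primitive1 n i a b : -1 < a -> moment_primitive n i a b 1 = 0.
Proof.
move=> a1; apply: big1 => k _; rewrite jacobipE weighted_jacobiP1 ?mulr0//.
by have : 0 <= k%:R :> R by []; lra.
Qed.

Lemma moment_primitiveN1 n i a b : -1 < b -> moment_primitive n i a b (-1) = 0.
Proof.
move=> b1; apply: big1 => k _; rewrite jacobipE weighted_jacobiPN1 ?mulr0//.
by have : 0 <= k%:R :> R by []; lra.
Qed.

Lemma moment_primitive0 n i a b : moment_primitive n i a b 0 =
  2 ^+ (i + 2) * Gamma (n%:R + a + b + 1) / Gamma (n%:R + i%:R + a + b + 2)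
  * jacobip (n - 1 - i) (a + 1 + i%:R) (b + 1 + i%:R) 0.
Proof.
rewrite /moment_primitive big_ord_recr/= big1 => [|k _]; last first.
  by rewrite expr0n subn_eq0 leqNgt ltn_ord !(mul0r, mulr0).
by rewrite add0r subnn expr0 fact0 divr1 mulr1.
Qed.

Lemma continuous_moment_primitive n i a b : -1 < a -> -1 < b ->
  {within `[-1, 1], continuous (moment_primitive n i a b)}.
Proof.
move=> a1 b1.
rewrite (_ : moment_primitive n i a b = \sum_(k < i.+1) (fun x =>
      (2 ^+ (k + 2) * Gamma (n%:R + a + b + 1) / Gamma (n%:R + k%:R + a + b + 2))
      * (x ^+ (i - k) / ((i - k)`!)%:R)
      * jacobip (n - 1 - k) (a + 1 + k%:R) (b + 1 + k%:R) x)); last first.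
  by apply/funext => z; rewrite fct_sumE.
elim/big_ind: _ => [x|f g cf cg x|k _ x].
- exact: cvg_cst.
- by apply: cvgD; [exact: cf|exact: cg].
- have k0 : 0 <= k%:R :> R by [].
  have cX : {within `[-1, 1], continuous (fun x : R => x ^+ (i - k))}.
    by apply: continuous_subspaceT => y; exact: exprn_continuous.
  have cJ : {within `[-1, 1], continuous
      (jacobip (n - 1 - k) (a + 1 + k%:R) (b + 1 + k%:R))}.
    rewrite (funext (jacobipE _ _ _)) => y; apply: cvgMr.
    by apply: continuous_weighted_jacobiP; lra.
  apply: cvgM; last exact: cJ.
  by apply: cvgMr; apply: cvgMl; exact: cX.
Qed.

(** The normalizing constant and the weight are nonnegative, so only the product over the zeros
    matters, and [j] of them lie to the left of [x]. *)
Lemma jacobip_sign n a b (t : nat -> R) j x : -1 < a -> -1 < b -> (0 < n)%N ->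
  (forall m, (1 <= m <= n)%N -> jacobiP n a b (t m) = 0) ->
  (forall m, (1 <= m < n)%N -> t m < t m.+1) -> (j <= n)%N ->
  (forall k, (1 <= k <= j)%N -> t k <= x) ->
  (forall k, (j < k <= n)%N -> x <= t k) ->
  0 <= (-1) ^+ (j + n) * jacobip n a b x.
Proof.
move=> a1 b1 n0 t0 t_lt jn lo hi.
have [_ [c c0 PE]] := jacobiP_factorization n a b t a1 b1 t0 t_lt.
have n1 : 1 <= n%:R :> R by rewrite ler1n.
rewrite jacobipE mulrCA mulr_ge0//; first by apply: jacobip_coef_ge0; lra.
rewrite /weighted_jacobiP PE mulrCA; apply: mulr_ge0.
  by rewrite mulr_ge0 ?powR_ge0.
by rewrite mulrCA mulr_ge0 ?prod_subr_sign// ltW.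
Qed.

End JacobiFunctions.

(** * Evaluation of the absolute moments *)

Theorem theorem4p5 (R : realType) (n i : nat) (alpha beta : R) (t : nat -> R) (n0 : nat) :
  (1 <= n)%N -> (i <= n - 1)%N -> -1 < alpha -> -1 < beta ->
  (* t_1 < ... < t_n are the zeros of P_n^(alpha,beta) *)
  (forall m, (1 <= m <= n)%N -> jacobiP n alpha beta (t m) = 0) ->
  (forall m, (1 <= m < n)%N -> t m < t m.+1) ->
  (* conventions t_0 = -1, t_(n+1) = 1 *)
  t 0%N = -1 -> t n.+1 = 1 ->
  (n0 <= n)%N -> t n0 <= 0 < t n0.+1 ->
  let A := fun m : nat =>
    \sum_(k < i.+1)
      (2 ^+ (k + 2) * Gamma (n%:R + alpha + beta + 1)
        / Gamma (n%:R + k%:R + alpha + beta + 2))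
      * ((t m) ^+ (i - k) / ((i - k)`!)%:R)
      * jacobip (n - 1 - k) (alpha + 1 + k%:R) (beta + 1 + k%:R) (t m) in
  let I := (\int[@lebesgue_measure R]_(s in `[(-1)%R, 1%R])
             ((`|s| ^+ i / (i`!)%:R) * `|jacobip n alpha beta s|)%:E)%E in
  (~~ odd i ->
     I = (\sum_(1 <= m < n.+1) (-1) ^+ (m + n) * A m)%:E) /\
  (odd i ->
     I = (\sum_(1 <= m < n0.+1) (-1) ^+ (m + n + 1) * A m
          + (-1) ^+ (n0 + n) * (2 ^+ (i + 2) * Gamma (n%:R + alpha + beta + 1)
               / Gamma (n%:R + i%:R + alpha + beta + 2))
            * jacobip (n - 1 - i) (alpha + 1 + i%:R) (beta + 1 + i%:R) 0
          + \sum_(n0.+1 <= m < n.+1) (-1) ^+ (m + n) * A m)%:E).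
Proof.
move=> n_gt0 i_le a1 b1 tP t_lt tl tr n0n /andP[t_n0 n0_t] A I.
have i_n : (i < n)%N by rewrite -(subnK n_gt0) addn1 ltnS.
have [t_in _] := jacobiP_factorization n alpha beta t a1 b1 tP t_lt.
have t_inc m : (m <= n)%N -> t m < t m.+1.
  case: (posnP m) => [-> _|m0 mn]; first by rewrite tl; have /andP[] := t_in 1%N n_gt0.
  move: mn; rewrite leq_eqVlt => /predU1P[->|mn]; last by apply: t_lt; rewrite m0.
  by rewrite tr; have := t_in n; rewrite n_gt0 leqnn => /(_ isT)/andP[].
have t_mono := ler_nodes _ _ _ (fun m mn => ltW (t_inc m mn)).
pose F := moment_primitive n i alpha beta.
pose f x := x ^+ i / i`!%:R * jacobip n alpha beta x.
have IE : I = (\int[@lebesgue_measure R]_(s in `[(-1)%R, 1%R]) `|f s|%:E)%E.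
  apply: eq_integral => x _; congr (_%:E).
  by rewrite [RHS]normrM (normrM (x ^+ i)) normrX normfV normr_nat.
have cF : {within `[-1, 1], continuous F}.
  exact: (continuous_moment_primitive n i alpha beta a1 b1).
have dF (x : R) : x \in `]-1, 1[ -> is_derive x 1 F (- 2 * f x).
  by rewrite in_itv/= => x1; exact: (is_derive_moment_primitive n i alpha beta x i_n a1 b1 x1).
have cf : {in `]-1, 1[, continuous f}.
  move=> x; rewrite in_itv/= => x1; apply: cvgM.
    by apply: cvgMl; exact: exprn_continuous.
  rewrite (funext (jacobipE n alpha beta)); apply: cvgMr.
  exact/differentiable_continuous/derivable1_diffP/derivable_weighted_jacobiP.
have F1 : F 1 = 0 by exact: (moment_primitive1 n i alpha beta a1).
have FN1 : F (-1) = 0 by exact: (moment_primitiveN1 n i alpha beta b1).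
have psign j x : (j <= n)%N -> t j <= x <= t j.+1 ->
    0 <= (-1) ^+ (j + n) * jacobip n alpha beta x.
  move=> jn /andP[tjx xtj]; apply: (jacobip_sign _ _ _ t) => // k /andP[k1 k2].
    by apply: le_trans tjx; apply: t_mono; rewrite k2 leqW.
  by apply: le_trans xtj _; apply: t_mono; rewrite k1 leqW.
split=> oddi; rewrite IE.
  (* For even [i] the factor [x ^+ i] is nonnegative, so the zeros suffice as nodes, and [F (t m)]
     is [A m] by definition. *)
  have := @integral_norm_alternating _ f F t n; rewrite tl tr => -> //.
    by move=> m mn; exact/ltW/t_inc.
  move=> m x mn; rewrite in_itv/= => /andP[x1 x2].
  rewrite /f mulrCA mulr_ge0 ?psign ?(ltW x1) ?(ltW x2)//.
  by rewrite divr_ge0 ?exprn_even_ge0.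
(* [x ^+ i] changes sign at 0, which is inserted as an extra node after [t n0]. *)
pose u m := if (m <= n0)%N then t m else if m == n0.+1 then 0 else t m.-1.
have u0 : u 0%N = -1 by [].
have u1 : u n.+2 = 1.
  by rewrite /u leqNgt !ltnS (leqW n0n)/= gtn_eqF.
have u_lo m : (m <= n0)%N -> u m = t m by rewrite /u => ->.
have u_mid : u n0.+1 = 0 by rewrite /u ltnn eqxx.
have u_hi m : (n0 < m)%N -> u m.+1 = t m.
  by move=> h; rewrite /u leqNgt ltnS (ltnW h)/= eqSS gtn_eqF.
have := @integral_norm_alternating _ f F u n.+1; rewrite u0 u1 => -> //.
(* With [n.+1] inner nodes the sign at node [m] is [(-1) ^+ (m + n.+1)], as in the first sum. Past 0
   the zero [t m] is node [m.+1], and this second shift restores [(-1) ^+ (m + n)]. *)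
- congr (_%:E); rewrite (big_cat_nat (n := n0.+1))//=; last by rewrite ltnS leqW.
  rewrite -addrA; congr (_ + _).
    apply: eq_big_nat => m; rewrite ltnS => /andP[_ mn0].
    by rewrite u_lo// addnS addn1.
  rewrite big_ltn ?ltnS// u_mid addSn addnS !exprS !mulN1r opprK.
  rewrite /F moment_primitive0 -[in RHS]mulrA; congr (_ + _).
  rewrite big_add1/=; apply: eq_big_nat => m /andP[n0m _].
  by rewrite u_hi// addSn addnS !exprS !mulN1r opprK.
- move=> m mn; case: (ltngtP m n0) => [m_lt|m_gt|->].
  + by rewrite !u_lo// ?(ltnW m_lt)//; apply/ltW/t_inc/(leq_trans (ltnW m_lt)).
  + case: m m_gt mn => // m; rewrite ltnS leq_eqVlt => /predU1P[<- _|m_gt mn].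
      by rewrite u_mid u_hi// ltW.
    by rewrite (u_hi m m_gt) (u_hi m.+1 (leqW m_gt)); exact/ltW/t_inc.
  + by rewrite u_lo// u_mid.
- have sgnE m x : (-1) ^+ (m + n.+1) * f x =
    - (x ^+ i / i`!%:R) * ((-1) ^+ (m + n) * jacobip n alpha beta x).
    by rewrite /f addnS exprS; ring.
  move=> m x mn; rewrite in_itv/=; case: (leqP m n0) => [m_le|m_gt].
    rewrite u_lo// => /andP[x1 x2]; rewrite sgnE.
    (* The piece from [t n0] ends at 0, short of [t n0.+1]; the earlier ones end at a zero that is
       at most [t n0 <= 0]. *)
    have [x0 xt] : x <= 0 /\ x <= t m.+1.
      move: m_le x2; rewrite leq_eqVlt => /predU1P[->|m_lt].
        by rewrite u_mid => /ltW h; split=> //; exact: le_trans (ltW n0_t).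
      rewrite u_lo// => /ltW h; split=> //; apply: (le_trans h).
      by apply: le_trans t_n0; apply: t_mono; rewrite m_lt/= leqW.
    apply: mulr_ge0; last by rewrite psign ?(ltW x1)// (leq_trans m_le).
    by rewrite oppr_ge0 mulr_le0_ge0 ?exprn_odd_le0 ?invr_ge0.
  case: m m_gt mn => // m; rewrite ltnS => m_ge mn /andP[x1 x2].
  (* Right of 0 the node index exceeds the number of zeros passed by one, and this sign cancels the
     one from [n.+1]. *)
  rewrite addSn exprS mulN1r mulNr sgnE mulNr opprK.
  rewrite u_hi ?ltnS// in x2.
  have [x0 xt] : 0 <= x /\ t m <= x.
    move: m_ge x1; rewrite leq_eqVlt => /predU1P[<-|m_lt].
      by rewrite u_mid => /ltW h; split=> //; exact: le_trans h.
    rewrite u_hi// => /ltW h; split=> //; apply: le_trans h.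
    by apply: le_trans (ltW n0_t) _; apply: t_mono; rewrite m_lt leqW.
  apply: mulr_ge0; last by rewrite psign// xt ltW.
  by rewrite divr_ge0 ?exprn_ge0.
Qed.
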